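(* All digraphs are finite, weakly connected and without multiple arcs. For each digraph $G$ with $w(G)>0$ let $\varphi_G: G\to C_{w(G)}$ be an epimorphism as described in the context, and for each digraph $G$ with $w(G)=0$ let $\varphi_G: G\to P_{d(G)}$ be the unique epimorphism. (1) Let $w(G_1)>0$ and $w(G_2)>0$. If $\psi: G_1\to G_2$ is an epimorphism, then $\psi$ induces an epimorphism $\tilde\psi: C_{w(G_1)}\to C_{w(G_2)}$ making the diagram commute, i.e. $\tilde\psi\circ\varphi_{G_1}=\varphi_{G_2}\circ\psi$. In other words, $\Phi: G\mapsto C_{w(G)},\ \psi\mapsto\tilde\psi$ is a functor from the category of digraphs with positive weight to the category of directed cycles. (2) Let $w(G_1)=w(G_2)=0$. If $\varepsilon: G_1\to G_2$ is a homomorphism, then $\varepsilon$ induces an epimorphism $\tilde\varepsilon: P_{d(G_1)}\to P_{d(G_2)}$ making the diagram commute, i.e. $\tilde\varepsilon\circ\varphi_{G_1}=\varphi_{G_2}\circ\varepsilon$. In other words, $\Phi: G\mapsto P_{d(G)},\ \varepsilon\mapsto\tilde\varepsilon$ is a functor from the category of digraphs with zero weight to the category of directed paths.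
   Context: A digraph is a pair $G=(V,E)$ with $V$ a finite set and $E\subseteq V\times V$ (loops are allowed, multiple arcs are not). For an arc $(u,v)\in E$, $u$ is its initial vertex and $v$ its end vertex. The directed cycle $C_n$ is the digraph with vertex set $\{0,1,\dots,n-1\}$ and arc set $\{(0,1),(1,2),\dots,(n-1,0)\}$; in particular $C_1$ is a single vertex with a loop. The directed path $P_n$ is $C_n$ with the arc $(n-1,0)$ removed. A route $R=(S,\sigma)$ of length $n$ in $G$ consists of a sequence of vertices $S=(v_0,\dots,v_n)$ and a sequence $\sigma=(\sigma_1,\dots,\sigma_n)\in\{1,-1\}^n$ such that, for each $i=1,\dots,n$, $(v_{i-1},v_i)\in E$ if $\sigma_i=1$ and $(v_i,v_{i-1})\in E$ if $\sigma_i=-1$. Its weight is $\sigma(R)=\sum_{i=1}^n\sigma_i$. The route is closed if $v_0=v_n$. $G$ is weakly connected if any two vertices are joined by a route. The weight of $G$ is $w(G)=\gcd(W)$, where $W$ is the set of positive integers $n$ such that some closed route $R$ in $G$ has $\sigma(R)=n$; if $W=\emptyset$, then $w(G)=0$. The diameter $d(G)$ is the maximal weight of routes in $G$. A homomorphism of digraphs $G_1\to G_2$ is a map sending vertices to vertices and arcs to arcs, compatible with taking initial vertices and end vertices of arcs. An epimorphism is a homomorphism that is surjective. The source states as previous results that an epimorphism $\varphi_G: G\to C_{w(G)}$ exists whenever $w(G)>0$ (obtained by fixing a vertex $p$ and sending a vertex $q$ to $\sigma(R)\bmod w(G)$ for any route $R$ from $p$ to $q$), and that there is a unique epimorphism $\varphi_G: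 G\to P_{d(G)}$ whenever $w(G)=0$.
   Formalization: In (2), P_{d(G)} is replaced by the directed path with d(G)+1 vertices, as no homomorphism to P_{d(G)} exists; a homomorphism ε induces a homomorphism of paths, stated to be an epimorphism only if ε is one (a single vertex mapped into P_2 refutes the original). *)

(* Defs.v *)
From HB Require Import structures.
From mathcomp Require Import all_boot all_order all_algebra.
From mathcomp Require Import boolp classical_sets.

Set Implicit Arguments.
Unset Strict Implicit.
Unset Printing Implicit Defensive.

Import Order.TTheory GRing.Theory Num.Theory.

Local Open Scope ring_scope.

Record digraph := Digraph { vertex :> finType; arc : rel vertex }.

Definition dicycle (n : nat) : digraph :=
  @Digraph 'I_n (fun i j => (j == i.+1 %% n :> nat)%N).

Definition dipath (n : nat) : digraph :=
  @Digraph 'I_n (fun i j =>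
    @arc (dicycle n) i j && ~~ ((i == n.-1 :> nat) && (j == 0 :> nat))%N).

(* [rvert i] is v_i for i = 0, ..., n, and [rsign i] is sigma_(i+1) for
   i = 0, ..., n - 1. *)
Record route (G : digraph) := Route {
  rlen : nat;
  rvert : 'I_rlen.+1 -> G;
  rsign : 'I_rlen -> int;
  routeP : forall i : 'I_rlen,
    let u := rvert (widen_ord (leqnSn rlen) i) in
    let v := rvert (lift ord0 i) in
    (rsign i = 1 /\ arc u v) \/ (rsign i = -1 /\ arc v u) }.

Arguments rvert [G] r i.
Arguments rsign [G] r i.

Definition rstart (G : digraph) (R : route G) : G := rvert R ord0.
Definition rend (G : digraph) (R : route G) : G := rvert R ord_max.

Definition rweight (G : digraph) (R : route G) : int :=
  \sum_(i < rlen R) rsign R i.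

Definition closed_route (G : digraph) (R : route G) : Prop :=
  rstart R = rend R.

(* The digraph without vertices is not considered to be connected; it has no
   routes, hence no diameter. *)
Definition weakly_connected (G : digraph) : Prop :=
  (exists v : G, True) /\
  forall u v : G, exists R : route G, rstart R = u /\ rend R = v.

(* Greatest for divisibility; in particular the gcd of the empty set is 0. *)
Definition is_gcd (W : set nat) (g : nat) : Prop :=
  (forall n, W n -> g %| n)%N /\
  (forall d, (forall n, W n -> d %| n) -> d %| g)%N.

Definition set_gcd (W : set nat) : nat := xget 0%N (is_gcd W).

Lemma is_gcd_inj (W : set nat) (g h : nat) : is_gcd W g -> is_gcd W h -> g = h.
Proof.
move=> [g1 g2] [h1 h2]; apply/eqP.
by rewrite eqn_dvd h2 // g2.
Qed.

Lemma is_gcd_ex (W : set nat) : exists g, is_gcd W g.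
Proof.
have [W0|] := pselect (forall n, W n -> n = 0%N).
  by exists 0%N; split=> [n /W0->|d _]; rewrite dvdn0.
move=> /existsNP[n /not_implyP[Wn /eqP n0]].
pose Q g := (0 < g)%N /\
  forall d, (forall n, W n -> d %| n)%N -> (d %| g)%N.
have: Q n by split; [rewrite lt0n|move=> d; apply].
elim/ltn_ind: n {Wn n0} => g IH [g0 Qg].
have [gW|/existsNP[m /not_implyP[Wm /negP gm]]] :=
  pselect (forall n, W n -> g %| n)%N; first by exists g.
apply: (IH (gcdn g m)); last first.
  by split=> [|d dW]; rewrite ?gcdn_gt0 ?g0 // dvdn_gcd Qg ?dW.
rewrite ltn_neqAle (dvdn_leq g0 (dvdn_gcdl g m)) andbT.
by apply: contra gm => /eqP <-; exact: dvdn_gcdr.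
Qed.

Lemma set_gcdP (W : set nat) : is_gcd W (set_gcd W).
Proof. by rewrite /set_gcd; case: xgetP => [//|]; have [g Wg] := is_gcd_ex W => /(_ g). Qed.

Lemma set_gcd0 : set_gcd set0 = 0%N.
Proof. by apply: (is_gcd_inj (set_gcdP _)); split=> // d _; rewrite dvdn0. Qed.

Definition weight (G : digraph) : nat :=
  set_gcd [set n : nat | (0 < n)%N /\
    exists R : route G, closed_route R /\ rweight R = n%:Z].

(* The maximum, when it exists, is nonnegative, since a route of length 0 has
   weight 0. It does not exist if G has positive weight, and then the value
   below is irrelevant. *)
Definition diameter (G : digraph) : nat :=
  xget 0%N [set d : nat | (exists R : route G, rweight R = d%:Z) /\
                          forall R : route G, rweight R <= d%:Z].

(* As there are no multiple arcs, the map on arcs is determined by the map on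
   vertices. *)
Definition is_hom (G H : digraph) (f : G -> H) : Prop :=
  forall u v : G, arc u v -> arc (f u) (f v).

Definition is_epi (G H : digraph) (f : G -> H) : Prop :=
  [/\ is_hom f,
      forall y : H, exists x : G, f x = y &
      forall y z : H, arc y z -> exists u v : G, [/\ arc u v, f u = y & f v = z]].

Record dihom (G H : digraph) := Hom { hom_fun :> G -> H; homP : is_hom hom_fun }.
Record diepi (G H : digraph) := Epi { epi_fun :> G -> H; epiP : is_epi epi_fun }.

Lemma hom_ext (G H : digraph) (f g : dihom G H) : f =1 g -> f = g.
Proof.
case: f g => [f fP] [g gP] /= /funext fg; case: _ / fg in gP *.
by rewrite (Prop_irrelevance fP gP).
Qed.

Lemma epi_ext (G H : digraph) (f g : diepi G H) : f =1 g -> f = g.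
Proof.
case: f g => [f fP] [g gP] /= /funext fg; case: _ / fg in gP *.
by rewrite (Prop_irrelevance fP gP).
Qed.

Lemma is_hom_id (G : digraph) : is_hom (@id G).
Proof. by []. Qed.

Lemma is_hom_comp (G H K : digraph) (g : H -> K) (f : G -> H) :
  is_hom g -> is_hom f -> is_hom (g \o f).
Proof. by move=> gP fP u v /fP/gP. Qed.

Lemma is_epi_id (G : digraph) : is_epi (@id G).
Proof. by split=> [//|y|y z yz]; [exists y|exists y, z]. Qed.

Lemma is_epi_comp (G H K : digraph) (g : H -> K) (f : G -> H) :
  is_epi g -> is_epi f -> is_epi (g \o f).
Proof.
move=> [gh gv ga] [fh fv fa]; split; first exact: is_hom_comp.
  by move=> z; have [y <-] := gv z; have [x <-] := fv y; exists x.
move=> y z /ga[u [v [/fa[a [b [ab <- <-]]] <- <-]]].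
by exists a, b.
Qed.

Definition hom_id (G : digraph) : dihom G G := Hom (@is_hom_id G).
Definition hom_comp (G H K : digraph) (g : dihom H K) (f : dihom G H) : dihom G K :=
  Hom (is_hom_comp (homP g) (homP f)).
Definition epi_id (G : digraph) : diepi G G := Epi (@is_epi_id G).
Definition epi_comp (G H K : digraph) (g : diepi H K) (f : diepi G H) : diepi G K :=
  Epi (is_epi_comp (epiP g) (epiP f)).

Lemma hom_comp1f (G H : digraph) (f : dihom G H) : hom_comp (hom_id H) f = f.
Proof. exact: hom_ext. Qed.

Lemma hom_compf1 (G H : digraph) (f : dihom G H) : hom_comp f (hom_id G) = f.
Proof. exact: hom_ext. Qed.

Lemma hom_compA (G H K L : digraph) (h : dihom K L) (g : dihom H K) (f : dihom G H) :
  hom_comp h (hom_comp g f) = hom_comp (hom_comp h g) f.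
Proof. exact: hom_ext. Qed.

Lemma epi_comp1f (G H : digraph) (f : diepi G H) : epi_comp (epi_id H) f = f.
Proof. exact: epi_ext. Qed.

Lemma epi_compf1 (G H : digraph) (f : diepi G H) : epi_comp f (epi_id G) = f.
Proof. exact: epi_ext. Qed.

Lemma epi_compA (G H K L : digraph) (h : diepi K L) (g : diepi H K) (f : diepi G H) :
  epi_comp h (epi_comp g f) = epi_comp (epi_comp h g) f.
Proof. exact: epi_ext. Qed.

Record category := Category {
  obj :> Type;
  mor : obj -> obj -> Type;
  idm : forall a, mor a a;
  compm : forall a b c, mor b c -> mor a b -> mor a c;
  comp1m : forall a b (f : mor a b), compm (idm b) f = f;
  compm1 : forall a b (f : mor a b), compm f (idm a) = f;
  compA : forall a b c d (h : mor c d) (g : mor b c) (f : mor a b),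
    compm h (compm g f) = compm (compm h g) f }.

Definition is_functor (C D : category) (F0 : C -> D)
    (F1 : forall a b : C, mor a b -> mor (F0 a) (F0 b)) : Prop :=
  (forall a : C, F1 a a (idm a) = idm (F0 a)) /\
  (forall (a b c : C) (g : mor b c) (f : mor a b),
     F1 a c (compm g f) = compm (F1 b c g) (F1 a b f)).

(* The categories of the digraphs [D t], with all homomorphisms, respectively
   all epimorphisms, as morphisms. *)
Definition hom_cat (T : Type) (D : T -> digraph) : category :=
  {| obj := T;
     mor := fun a b => dihom (D a) (D b);
     idm := fun a => hom_id (D a);
     compm := fun a b c => @hom_comp (D a) (D b) (D c);
     comp1m := fun a b f => hom_comp1f f;
     compm1 := fun a b f => hom_compf1 f;
     compA := fun a b c d h g f => hom_compA h g f |}.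

Definition epi_cat (T : Type) (D : T -> digraph) : category :=
  {| obj := T;
     mor := fun a b => diepi (D a) (D b);
     idm := fun a => epi_id (D a);
     compm := fun a b c => @epi_comp (D a) (D b) (D c);
     comp1m := fun a b f => epi_comp1f f;
     compm1 := fun a b f => epi_compf1 f;
     compA := fun a b c d h g f => epi_compA h g f |}.

Record pos_digraph := PosDigraph {
  pos_val :> digraph;
  pos_connected : weakly_connected pos_val;
  pos_weight : (0 < weight pos_val)%N }.

Record zero_digraph := ZeroDigraph {
  zero_val :> digraph;
  zero_connected : weakly_connected zero_val;
  zero_weight : weight zero_val = 0%N }.

Record posnat := Posnat { posnat_val :> nat; posnat_gt0 : (0 < posnat_val)%N }.

Definition PosDigraphs : category := epi_cat pos_val.
Definition DirectedCycles : category := epi_cat (fun n : posnat => dicycle n).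
Definition ZeroDigraphs : category := hom_cat zero_val.
Definition DirectedPaths : category := hom_cat (fun n : posnat => dipath n).

Definition cycle_of (G : PosDigraphs) : DirectedCycles :=
  Posnat (pos_weight G).

(* [dipath n] has n vertices, hence diameter n - 1, so that a digraph of weight 0
   and diameter d maps onto the directed path with d + 1 vertices. *)
Definition path_of (G : ZeroDigraphs) : DirectedPaths :=
  Posnat (ltn0Sn (diameter G)).

Definition residue_map (G : digraph) (f : G -> dicycle (weight G)) : Prop :=
  exists p : G, forall (q : G) (R : route G),
    rstart R = p -> rend R = q -> (f q : nat)%:Z = (rweight R %% weight G)%Z.

(* Main.v *)
Require Import Defs.
From HB Require Import structures.
From mathcomp Require Import all_boot all_order all_algebra.
From mathcomp Require Import boolp classical_sets.
From mathcomp Require Import ring zify.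

(** Both parts reduce to one assertion about fibres.  Let [f : G1 -> H] be the
    given epimorphism onto a cycle or a path and let [g] be the composite of the
    homomorphism [G1 -> G2] with the given epimorphism of [G2].  An epimorphism
    is surjective on vertices and on arcs, so as soon as [g] is constant on the
    fibres of [f] it factors through [f] in exactly one way, the factor is a
    homomorphism, and it is an epimorphism when [g] is ([factor_hom],
    [factor_epi]).

    To see that [g] is constant on the fibres of [f], read the position in
    [C_n] or [P_n] as an integer.  Along an arc it grows by 1, modulo [n] for the
    cycle and exactly, that is modulo 0, for the path; hence along a route it
    grows by the weight of the route ([potential_route]).  If [f u = f v], a
    route from [u] to [v] has weight 0 modulo [w(G1)] (respectively weight 0).
    For cycles one also needs that [w(G2)] divides [w(G1)]: every closed route of
    [G1] has weight 0 modulo [w(G2)], because [g] is a potential modulo [w(G2)]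
    ([potential_dvd_weight]).  Then the position of [g] is the same at [u] and at
    [v].

    Functoriality follows from uniqueness of the induced map: commuting squares
    contain the identities and can be pasted ([functor_of_unique]). *)

Set Implicit Arguments.
Unset Strict Implicit.
Unset Printing Implicit Defensive.

Import Order.TTheory GRing.Theory Num.Theory.
Local Open Scope ring_scope.

(** The modulus 0 is meant to be allowed: such a potential is exact, as on a
    directed path. *)
Definition potential (G : digraph) (n : nat) (p : G -> int) : Prop :=
  forall u v : G, Defs.arc u v -> (n %| p v - p u - 1)%Z.

Lemma telescope_ord (V : zmodType) (n : nat) (F : 'I_n.+1 -> V) :
  \sum_(i < n) (F (lift ord0 i) - F (widen_ord (leqnSn n) i)) =
  F ord_max - F ord0.
Proof.
rewrite sumrB; apply/eqP; rewrite subr_eq; apply/eqP; apply: (addrI (F ord0)).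
by rewrite -big_ord_recl big_ord_recr addrA [F ord0 + _]addrC subrK addrC.
Qed.

(** The defect of the increment of [p] against the weight is the sum of the
    defects of the single steps. *)
Lemma potential_route (G : digraph) (n : nat) (p : G -> int) (R : route G) :
  potential n p -> (n %| p (rend R) - p (rstart R) - rweight R)%Z.
Proof.
move=> pP; rewrite /rend /rstart /rweight.
rewrite -(telescope_ord (fun i => p (rvert R i))) -sumrB.
apply: rpred_sum => i _.
have [[-> /pP //]|[-> /pP]] := routeP i.
by rewrite -rpredN; congr (_ %| _)%Z; ring.
Qed.

Lemma potential_dvd_weight (G : digraph) (n : nat) (p : G -> int) :
  potential n p -> (n %| weight G)%N.
Proof.
move=> pP; apply: (set_gcdP _).2 => k [_ [R [Rc Rk]]].
have := potential_route R pP.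
by rewrite -Rc Rk subrr sub0r rpredN.
Qed.

(** The weight of a route from [u] to [v] is 0 modulo [m], hence modulo [n], and
    it is the increment of [q] modulo [n]. *)
Lemma potential_fiber (G : digraph) (m n : nat) (p q : G -> int) (u v : G) :
  weakly_connected G -> potential m p -> potential n q -> (n %| m)%N ->
  p u = p v -> (n %| q v - q u)%Z.
Proof.
move=> [_ Gc] pP qP nm puv; have [R [Ru Rv]] := Gc u v.
have := potential_route R pP; have := potential_route R qP.
rewrite Ru Rv puv subrr sub0r rpredN => qR mR.
have nR : (n %| rweight R)%Z by apply: dvdz_trans mR.
by rewrite -(subrK (rweight R) (q v - q u)) rpredD.
Qed.

Lemma hom_dicycle_potential (G : digraph) (n : nat) (f : G -> dicycle n) :
  is_hom f -> potential n (fun u => (f u : nat)%:Z).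
Proof.
move=> fP u v /fP /= /eqP ->.
have := divn_eq (f u).+1 n; move: (_ %/ n)%N (_ %% n)%N => k r fE.
apply/dvdzP; exists (- k%:Z); lia.
Qed.

Lemma arc_dipath (n : nat) (i j : dipath n) : Defs.arc i j -> j = i.+1 :> nat.
Proof.
rewrite /= => /andP[/eqP ji]; move: (ltn_ord i) ji.
rewrite leq_eqVlt => /orP[/eqP i1|lt]; last by rewrite (modn_small lt).
(* The arc leaving the last vertex would be the one removed from the cycle. *)
by rewrite i1 modnn => ->; rewrite -[X in _ == X.-1]i1 /= !eqxx.
Qed.

Lemma hom_dipath_potential (G : digraph) (n : nat) (f : G -> dipath n) :
  is_hom f -> potential 0 (fun u => (f u : nat)%:Z).
Proof. by move=> fP u v /fP /arc_dipath ->; rewrite dvd0z; lia. Qed.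

Lemma dicycle_fiber (G : digraph) (m n : nat)
    (f : G -> dicycle m) (g : G -> dicycle n) (u v : G) :
  weakly_connected G -> is_hom f -> is_hom g -> (n %| m)%N ->
  f u = f v -> g u = g v.
Proof.
move=> Gc /hom_dicycle_potential fP /hom_dicycle_potential gP nm fuv.
have /= := potential_fiber Gc fP gP nm (congr1 (fun i : 'I_m => (i : nat)%:Z) fuv).
rewrite -eqz_mod_dvd !modz_nat !modn_small //.
by move=> /eqP[vu]; apply: val_inj.
Qed.

Lemma dipath_fiber (G : digraph) (m n : nat)
    (f : G -> dipath m) (g : G -> dipath n) (u v : G) :
  weakly_connected G -> is_hom f -> is_hom g -> f u = f v -> g u = g v.
Proof.
move=> Gc /hom_dipath_potential fP /hom_dipath_potential gP fuv.
have /= := potential_fiber Gc fP gP (dvdnn 0)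
  (congr1 (fun i : 'I_m => (i : nat)%:Z) fuv).
by rewrite dvd0z subr_eq0 => /eqP[vu]; apply: val_inj.
Qed.

Lemma factor_hom (G H K : digraph) (f : diepi G H) (g : dihom G K) :
  (forall u v, f u = f v -> g u = g v) -> exists! h : dihom H K, h \o f =1 g.
Proof.
move=> fg; have [_ fv fa] := epiP f.
pose h (y : H) : K := g (projT1 (cid (fv y))).
have hf u : h (f u) = g u by rewrite /h; case: cid => x /= /fg.
have hP : is_hom h.
  by move=> y z /fa[u [v [uv <- <-]]]; rewrite !hf; apply: homP.
exists (Defs.Hom hP); split=> // h' h'f; apply: hom_ext => y /=.
by have [x <-] := fv y; rewrite hf -h'f.
Qed.

Lemma factor_epi (G H K : digraph) (f : diepi G H) (g : diepi G K) :
  (forall u v, f u = f v -> g u = g v) -> exists! h : diepi H K, h \o f =1 g.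
Proof.
have [gh gv ga] := epiP g => fg.
have [h [hf hu]] := @factor_hom _ _ _ f (Defs.Hom gh) fg.
have hP : is_epi h.
  split; first exact: homP.
    by move=> z; have [x <-] := gv z; exists (f x); apply: hf.
  move=> y z /ga[u [v [uv <- <-]]]; exists (f u), (f v).
  by split; [case: (epiP f) => fh _ _; apply: fh|apply: hf|apply: hf].
exists (Epi hP); split=> // h' h'f; apply: epi_ext => y /=.
have [h'h _ _] := epiP h'.
by rewrite (hu (Defs.Hom h'h) h'f).
Qed.

(** The image of a composite and the composite of the images are both related
    to the composite, hence equal. *)
Lemma functor_of_unique (C D : category) (F0 : C -> D)
    (P : forall a b : C, mor a b -> mor (F0 a) (F0 b) -> Prop) :
  (forall a b (f : mor a b), exists! g, P a b f g) ->
  (forall a, P a a (idm a) (idm (F0 a))) ->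
  (forall a b c (g : mor b c) (f : mor a b) g' f',
     P b c g g' -> P a b f f' -> P a c (compm g f) (compm g' f')) ->
  exists F1 : forall a b : C, mor a b -> mor (F0 a) (F0 b),
    is_functor F1 /\ forall a b f, P a b f (F1 a b f).
Proof.
move=> Pex Pid Pcomp.
pose F1 a b (f : mor a b) := projT1 (cid (Pex a b f)).
have F1P a b f : P a b f (F1 a b f) by rewrite /F1; case: cid => g [].
have F1u a b f g : P a b f g -> F1 a b f = g.
  by move=> fg; rewrite /F1; case: cid => g' /= [_ g'u]; apply: g'u.
exists F1; split=> //; split; first by move=> a; apply/F1u/Pid.
by move=> a b c g f; apply/F1u/Pcomp.
Qed.

Theorem theorem1p11
  (phiC : forall G : pos_digraph, diepi G (dicycle (weight G)))
  (phiCP : forall G : pos_digraph, residue_map (phiC G))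
  (phiP : forall G : zero_digraph, diepi G (dipath (diameter G).+1)) :
  (* (1) *)
  ((forall (G1 G2 : pos_digraph) (psi : diepi G1 G2),
      exists! psi' : diepi (dicycle (weight G1)) (dicycle (weight G2)),
        psi' \o phiC G1 =1 phiC G2 \o psi) /\
   exists Phi : forall G1 G2 : PosDigraphs,
       mor G1 G2 -> mor (cycle_of G1) (cycle_of G2),
     is_functor Phi /\
     forall (G1 G2 : pos_digraph) (psi : diepi G1 G2),
       (Phi G1 G2 psi : diepi (dicycle (weight G1)) (dicycle (weight G2)))
         \o phiC G1 =1 phiC G2 \o psi) /\
  (* (2) *)
  ((forall (G1 G2 : zero_digraph) (eps : dihom G1 G2),
      (exists! eps' : dihom (dipath (diameter G1).+1) (dipath (diameter G2).+1),
         eps' \o phiP G1 =1 phiP G2 \o eps) /\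
      (is_epi eps ->
       exists! eps' : diepi (dipath (diameter G1).+1) (dipath (diameter G2).+1),
         eps' \o phiP G1 =1 phiP G2 \o eps)) /\
   exists Phi : forall G1 G2 : ZeroDigraphs,
       mor G1 G2 -> mor (path_of G1) (path_of G2),
     is_functor Phi /\
     forall (G1 G2 : zero_digraph) (eps : dihom G1 G2),
       (Phi G1 G2 eps : dihom (dipath (diameter G1).+1) (dipath (diameter G2).+1))
         \o phiP G1 =1 phiP G2 \o eps).
Proof.
have induced_epi (G1 G2 : pos_digraph) (psi : diepi G1 G2) :
    exists! psi' : diepi (dicycle (weight G1)) (dicycle (weight G2)),
      psi' \o phiC G1 =1 phiC G2 \o psi.
  have [fP _ _] := epiP (phiC G1).
  have [gP _ _] := epiP (epi_comp (phiC G2) psi).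
  apply: (@factor_epi _ _ _ (phiC G1) (epi_comp (phiC G2) psi)) => u v.
  apply: (dicycle_fiber (pos_connected G1) fP gP).
  exact: potential_dvd_weight (hom_dicycle_potential gP).
have fiber (G1 G2 : zero_digraph) (eps : dihom G1 G2) (u v : G1) :
    phiP G1 u = phiP G1 v -> phiP G2 (eps u) = phiP G2 (eps v).
  have [fP _ _] := epiP (phiP G1); have [gP _ _] := epiP (phiP G2).
  exact: dipath_fiber (zero_connected G1) fP (is_hom_comp gP (homP eps)).
have induced_hom (G1 G2 : zero_digraph) (eps : dihom G1 G2) :
    exists! eps' : dihom (dipath (diameter G1).+1) (dipath (diameter G2).+1),
      eps' \o phiP G1 =1 phiP G2 \o eps.
  have [gP _ _] := epiP (phiP G2).
  apply: (@factor_hom _ _ _ (phiP G1) (hom_comp (Defs.Hom gP) eps)).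
  exact: fiber.
split; split.
- exact: induced_epi.
- pose P (G1 G2 : PosDigraphs) (psi : mor G1 G2)
      (psi' : mor (cycle_of G1) (cycle_of G2)) :=
    (psi' : diepi (dicycle (weight G1)) (dicycle (weight G2))) \o phiC G1
      =1 phiC G2 \o (psi : diepi G1 G2).
  apply: (@functor_of_unique PosDigraphs DirectedCycles cycle_of P) => //.
  move=> G1 G2 G3 g f g' f' gP fP u /=.
  by rewrite -[RHS](gP (f u)) /=; congr (_ _); exact: fP.
- move=> G1 G2 eps; split=> [|epsP]; first exact: induced_hom.
  apply: (@factor_epi _ _ _ (phiP G1) (epi_comp (phiP G2) (Epi epsP))).
  exact: fiber.
- pose P (G1 G2 : ZeroDigraphs) (eps : mor G1 G2)
      (eps' : mor (path_of G1) (path_of G2)) :=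
    (eps' : dihom (dipath (diameter G1).+1) (dipath (diameter G2).+1))
      \o phiP G1 =1 phiP G2 \o (eps : dihom G1 G2).
  apply: (@functor_of_unique ZeroDigraphs DirectedPaths path_of P) => //.
  move=> G1 G2 G3 g f g' f' gP fP u /=.
  by rewrite -[RHS](gP (f u)) /=; congr (_ _); exact: fP.
Qed.
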